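(* Let $n>1$ be an integer. Let $\mathfrak{M}$ and $\Gamma$ be additive groups such that $\mathfrak{M}$ is a $\Gamma$-ring. Suppose that $\mathfrak{M}$ contains a family $\{e_\alpha \mid \alpha\in\Lambda\}$, where each $e_\alpha$ is a $\gamma_\alpha$-idempotent (for some $\gamma_\alpha\in\Gamma$), which satisfies: (i) For each $\alpha\in\Lambda$ there are two $\mathfrak{M}$-additive maps $f_\alpha:\Gamma\times\mathfrak{M}\to\mathfrak{M}$ and $f'_\alpha:\mathfrak{M}\times\Gamma\to\mathfrak{M}$ satisfying $f_\alpha(\gamma_\alpha,a)=a-e_\alpha\gamma_\alpha a$ and $f'_\alpha(a,\gamma_\alpha)=a-a\gamma_\alpha e_\alpha$ for all $a\in\mathfrak{M}$, such that, denoting $f_\alpha\beta a=f_\alpha(\beta,a)$, $a\beta f_\alpha=f'_\alpha(a,\beta)$, $1_\alpha\beta a=e_\alpha\beta a+f_\alpha\beta a$, $a\beta 1_\alpha=a\beta e_\alpha+a\beta f_\alpha$ (so that formally $1_\alpha=e_\alpha+f_\alpha$), one has $(a\beta f_\alpha)\gamma b=a\beta(f_\alpha\gamma b)$ for all $a,b\in\mathfrak{M}$ and $\beta,\gamma\in\Gamma$. (ii) If $x\in\mathfrak{M}$ is such that $x\Gamma\mathfrak{M}=0$, then $x=0$. (iii) If $x\in\mathfrak{M}$ is such that $e_\alpha\Gamma\mathfrak{M}\Gamma x=0$ for all $\alpha\in\Lambda$, then $x=0$ (and hence $\mathfrak{M}\Gamma x=0$ implies $x=0$). (iv) For each $\alpha\in\Lambda$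 and $x\in\mathfrak{M}$, if $(e_\alpha\gamma_\alpha x\gamma_\alpha e_\alpha)\Gamma\mathfrak{M}\Gamma(1_\alpha-e_\alpha)=0$, then $e_\alpha\gamma_\alpha x\gamma_\alpha e_\alpha=0$. Then any $n$-multiplicative derivation $d$ of $\mathfrak{M}$ is additive, i.e. $d(x+y)=d(x)+d(y)$ for all $x,y\in\mathfrak{M}$.
   Context: Let $\mathfrak{M}$ and $\Gamma$ be two (additively written) abelian groups. $\mathfrak{M}$ is called a $\Gamma$-ring (in the sense of Barnes) if there is a product $(x,\alpha,y)\mapsto x\alpha y$ on $\mathfrak{M}\times\Gamma\times\mathfrak{M}$ such that for all $x,y,z\in\mathfrak{M}$, $\alpha,\beta\in\Gamma$: $x\alpha y\in\mathfrak{M}$; $(x+y)\alpha z=x\alpha z+y\alpha z$ and $x\alpha(y+z)=x\alpha y+x\alpha z$; $x(\alpha+\beta)y=x\alpha y+x\beta y$; $(x\alpha y)\beta z=x\alpha(y\beta z)$. Longer products are thus written without parentheses. For $\gamma\in\Gamma$, a $\gamma$-idempotent is a nonzero element $e\in\mathfrak{M}$ with $e\gamma e=e$. A map $\Gamma\times\mathfrak{M}\to\mathfrak{M}$ or $\mathfrak{M}\times\Gamma\to\mathfrak{M}$ is $\mathfrak{M}$-additive if it is additive in its $\mathfrak{M}$-variable (for each fixed element of $\Gamma$). For subsets $\mathfrak{A},\mathfrak{B}\subseteq\mathfrak{M}$ and $\Theta\subseteq\Gamma$, $\mathfrak{A}\Theta\mathfrak{B}$ denotes the set of all finite sums $\sum_i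 a_i\gamma_i b_i$ with $a_i\in\mathfrak{A}$, $\gamma_i\in\Theta$, $b_i\in\mathfrak{B}$; a single element stands for the corresponding singleton. The symbol $1_\alpha-e_\alpha$ stands for $f_\alpha$, so $(e_\alpha\gamma_\alpha x\gamma_\alpha e_\alpha)\Gamma\mathfrak{M}\Gamma(1_\alpha-e_\alpha)=0$ means $f'_\alpha\big((e_\alpha\gamma_\alpha x\gamma_\alpha e_\alpha)\beta m,\gamma\big)=0$ for all $m\in\mathfrak{M}$, $\beta,\gamma\in\Gamma$. An $n$-multiplicative derivation of $\mathfrak{M}$ is a map $d:\mathfrak{M}\to\mathfrak{M}$ (not assumed additive) such that $$d(x_1\gamma_1x_2\gamma_2\cdots\gamma_{n-1}x_n)=\sum_{i=1}^n x_1\gamma_1\cdots\gamma_{i-1}d(x_i)\gamma_i\cdots\gamma_{n-1}x_n$$ for all $x_1,\dots,x_n\in\mathfrak{M}$ and $\gamma_1,\dots,\gamma_{n-1}\in\Gamma$. *)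

(* Defs.v *)
From HB Require Import structures.
From mathcomp Require Import all_boot all_algebra.
From mathcomp Require Import classical_sets.

Set Implicit Arguments.
Unset Strict Implicit.
Unset Printing Implicit Defensive.

Import GRing.Theory.
Local Open Scope classical_set_scope.
Local Open Scope ring_scope.

(* Gamma-rings in the sense of Barnes; [mul x a y] is the product x a y. *)
Record gamma_ring (M G : zmodType) (mul : M -> G -> M -> M) : Prop := {
  gamma_mulDl : forall x y a z, mul (x + y) a z = mul x a z + mul y a z;
  gamma_mulDr : forall x a y z, mul x a (y + z) = mul x a y + mul x a z;
  gamma_mulDm : forall x a b y, mul x (a + b) y = mul x a y + mul x b y;
  gamma_mulA : forall x a y b z, mul (mul x a y) b z = mul x a (mul y b z)
}.

Section GammaRing.

Variables (M G : zmodType) (mul : M -> G -> M -> M).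

Definition gamma_idempotent (c : G) (e : M) : Prop := e <> 0 /\ mul e c e = e.

Definition setprod (A : set M) (T : set G) (B : set M) : set M :=
  [set z | exists (k : nat) (a : 'I_k -> M) (c : 'I_k -> G) (b : 'I_k -> M),
     (forall i, [/\ A (a i), T (c i) & B (b i)]) /\
     z = \sum_(i < k) mul (a i) (c i) (b i)].

(* x_0 g_0 x_1 g_1 ... g_(k-1) x_k, a product of k.+1 factors; the entries of
   [x] and [g] beyond these indices are ignored. *)
Fixpoint gamma_word (k : nat) (x : nat -> M) (g : nat -> G) : M :=
  if k is k'.+1 then mul (gamma_word k' x g) (g k') (x k'.+1) else x 0%N.

(* Factors are numbered from 0, and n is meant to be positive. *)
Definition n_mult_derivation (n : nat) (d : M -> M) : Prop :=
  forall (x : nat -> M) (g : nat -> G),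
    d (gamma_word n.-1 x g) =
    \sum_(i < n)
       gamma_word n.-1 (fun j => if j == i then d (x j) else x j) g.

End GammaRing.

Definition M_additive_l (M G : zmodType) (f : G -> M -> M) : Prop :=
  forall b x y, f b (x + y) = f b x + f b y.

Definition M_additive_r (M G : zmodType) (f : M -> G -> M) : Prop :=
  forall b x y, f (x + y) b = f x b + f y b.

(* Main.v *)
Require Import Defs.
From HB Require Import structures.
From mathcomp Require Import all_boot all_algebra.
From mathcomp Require Import classical_sets.

Set Implicit Arguments.
Unset Strict Implicit.
Unset Printing Implicit Defensive.

Import GRing.Theory.
Local Open Scope classical_set_scope.
Local Open Scope ring_scope.

(* The defect D(x, y) = d(x + y) - d(x) - d(y) is a symmetric 2-cocycle, and
   expanding d on a product of n factors, one of which is a sum, shows that it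
   commutes with multiplication by the other factors.  Padding words with copies
   of e = e_alpha (as e c e = e for c = gamma_alpha), products of two factors
   suffice once they lie in e c M; by (iii) it is enough to show that D vanishes
   there.  Split e c M as M11 + M12, with M11 = e c M c e.  Condition (ii) gives
   D(M11, M12) = 0; multiplying D(e, a12) = 0 on the right gives
   D(b, a12 beta m) = 0 for every b in e c M, whence D(e c M, M12) = 0 by (ii)
   again; finally M11 multiplied by M (1 - e) lands in M12, so D(M11, M11) = 0 by
   (iv). *)

(** * Arithmetic of products in a Gamma-ring *)

Section Product.

Variables (M G : zmodType) (mul : M -> G -> M -> M).
Hypothesis hM : gamma_ring mul.

Lemma gamma_mul0l a y : mul 0 a y = 0.
Proof. by apply: (addIr (mul 0 a y)); rewrite -(gamma_mulDl hM) !add0r. Qed.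

Lemma gamma_mul0r x a : mul x a 0 = 0.
Proof. by apply: (addIr (mul x a 0)); rewrite -(gamma_mulDr hM) !add0r. Qed.

Lemma gamma_mulNl x a y : mul (- x) a y = - mul x a y.
Proof.
by apply: (addIr (mul x a y)); rewrite -(gamma_mulDl hM) !addNr gamma_mul0l.
Qed.

Lemma gamma_mulNr x a y : mul x a (- y) = - mul x a y.
Proof.
by apply: (addIr (mul x a y)); rewrite -(gamma_mulDr hM) !addNr gamma_mul0r.
Qed.

Lemma gamma_mulBl x y a z : mul (x - y) a z = mul x a z - mul y a z.
Proof. by rewrite (gamma_mulDl hM) gamma_mulNl. Qed.

Lemma gamma_mulBr x a y z : mul x a (y - z) = mul x a y - mul x a z.
Proof. by rewrite (gamma_mulDr hM) gamma_mulNr. Qed.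

Lemma gamma_mul_suml k (F : 'I_k -> M) a y :
  mul (\sum_(i < k) F i) a y = \sum_(i < k) mul (F i) a y.
Proof.
by apply: (big_morph (fun x => mul x a y)) => [x z|];
  rewrite ?(gamma_mulDl hM) ?gamma_mul0l.
Qed.

Lemma setprod_eq0 (A : set M) (T : set G) (B : set M) :
  (forall x a y, A x -> T a -> B y -> mul x a y = 0) ->
  setprod mul A T B = [set 0].
Proof.
move=> AB0; apply/seteqP; split=> [z [k [a [g [b [abP ->]]]]]|z ->] /=.
  by apply: big1 => i _; have [? ? ?] := abP i; apply: AB0.
(* The empty sum witnesses 0 even when one of the sets is empty. *)
exists 0%N, (fun=> 0), (fun=> 0), (fun=> 0).
by split=> [[]//|]; rewrite big_ord0.
Qed.

Lemma eq_gamma_word k x y (g h : nat -> G) :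
  (forall i, (i <= k)%N -> x i = y i) -> (forall i, (i < k)%N -> g i = h i) ->
  gamma_word mul k x g = gamma_word mul k y h.
Proof.
elim: k => [|k IHk] /= xy gh; first exact: xy.
rewrite IHk ?xy ?gh // => i ik; [exact/xy/leqW | exact/gh/leqW].
Qed.

Lemma gamma_word_idem k e c : mul e c e = e ->
  gamma_word mul k (fun=> e) (fun=> c) = e.
Proof. by move=> ece; elim: k => //= k ->. Qed.

End Product.

Definition defect (M : zmodType) (d : M -> M) (x y : M) : M :=
  d (x + y) - d x - d y.

(** * Formal properties of the defect of a map *)

Section Defect.

Variables (M : zmodType) (d : M -> M).
Local Notation D := (defect d).

Lemma defectC x y : D x y = D y x.
Proof. by rewrite /defect [y + x]addrC addrAC. Qed.

Lemma defect_eq0 x y : D x y = 0 <-> d (x + y) = d x + d y.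
Proof.
rewrite /defect -addrA -opprD; split=> [/eqP|->]; last exact: subrr.
by rewrite subr_eq0 => /eqP.
Qed.

(* The shape of d along a map F that multiplies by fixed factors: A collects
   the Leibniz terms in which d hits one of these factors. *)
Lemma defect_map (F A H : M -> M) x y :
  F (x + y) = F x + F y -> A (x + y) = A x + A y -> {morph H : u v / u - v} ->
  d (F (x + y)) = A (x + y) + H (d (x + y)) ->
  d (F x) = A x + H (d x) -> d (F y) = A y + H (d y) ->
  D (F x) (F y) = H (D x y).
Proof.
move=> FD AD HB dxy dx dy; rewrite /defect -FD dxy dx dy AD !HB.
rewrite -[A x + A y + _]addrA [- (A x + _)]opprD [A x + _ + _]addrACA subrr.
by rewrite add0r -[_ + _ - H (d x)]addrA opprD addrACA subrr add0r.
Qed.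

Lemma defect0 x : d 0 = 0 -> D x 0 = 0.
Proof. by move=> d0; apply/defect_eq0; rewrite d0 !addr0. Qed.

End Defect.

(** * Leibniz rule for short products and its effect on the defect *)

Section Idempotent.

Variables (M G : zmodType) (mul : M -> G -> M -> M).
Hypothesis hM : gamma_ring mul.
Variables (d : M -> M) (n : nat).
Hypotheses (n_gt1 : (1 < n)%N) (hd : n_mult_derivation mul n d).
Local Notation D := (defect d).

Lemma n_mult_derivation0 : d 0 = 0.
Proof.
have w0 k (x : nat -> M) g : x 0%N = 0 -> gamma_word mul k x g = 0.
  by move=> x0; elim: k => //= k ->; apply: gamma_mul0l.
have := hd (fun=> 0) (fun=> 0); case: n n_gt1 => [//|[//|m]] _ /=.
(* As [n] > 1, each Leibniz term keeps a zero factor: the last one when [d] hits the first, and the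
   first one otherwise. *)
rewrite gamma_mul0r // => ->; apply: big1 => -[[|i] ltim] _ /=.
  by rewrite gamma_mul0r.
by rewrite w0 // gamma_mul0l.
Qed.

Section OneIdempotent.

Variables (e : M) (c : G).
Hypothesis ece : mul e c e = e.

(* For n > 2 the operator q is left multiplication by e, for n = 2 it is the
   identity; S collects the terms in which d hits a padding factor e. *)
Lemma n_mult_derivation2 : exists S (q : M -> M),
  (q = id \/ q = mul e c) /\
  forall u b v, mul e c u = u ->
    d (mul u b v) = mul (mul S c u) b v + mul (q (d u)) b v + mul u b (d v).
Proof.
case: n n_gt1 hd => [//|[//|[|m]]] _ dP.
  exists 0, id; split=> [|u b v _]; first by left.
  have := dP (fun i => if i == 0%N then u else v) (fun=> b).
  by rewrite 2!big_ord_recr big_ord0 /= !gamma_mul0l // !add0r.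
pose w (i j : nat) := if j == i then d e else e.
exists (\sum_(i < m.+1) gamma_word mul m (w i) (fun=> c)), (mul e c).
split=> [|u b v eu]; first by right.
(* The word is e c e ... c e c u b v, with m + 1 copies of [e] and m + 3 = [n] factors in all. *)
pose x j := if (j <= m)%N then e else if j == m.+1 then u else v.
pose g j := if (j <= m)%N then c else b.
have gE h y : (forall j, (j <= m)%N -> y j = h j) ->
    gamma_word mul m.+2 y g =
    mul (mul (gamma_word mul m h (fun=> c)) c (y m.+1)) b (y m.+2).
  move=> yh /=; rewrite /g leqnn ltnn; congr (mul (mul _ _ _) _ _).
  by apply: eq_gamma_word => // j /ltnW ->.
have x_e j : (j <= m)%N -> x j = e by rewrite /x => ->.
have xu : x m.+1 = u by rewrite /x ltnn eqxx.
have xv : x m.+2 = v by rewrite /x ltnNge leqnSn /= gtn_eqF.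
have := dP x g; rewrite -[m.+3.-1]/(m.+2) (gE (fun=> e)) // xu xv.
rewrite gamma_word_idem // eu => ->; rewrite 2!big_ord_recr /=.
congr (_ + _ + _).
- rewrite !gamma_mul_suml //; apply: eq_bigr => i _.
  have im := ltn_ord i.
  rewrite -/(gamma_word mul m.+2 _ g) (gE (w i)) => [|j /x_e -> //].
  by rewrite !gtn_eqF ?xu ?xv // ltnW.
- rewrite -/(gamma_word mul m.+2 _ g) (gE (fun=> e)) => [|j jm]; last first.
    by rewrite x_e ?ltn_eqF.
  by rewrite gamma_word_idem // eqxx gtn_eqF // xu xv.
- rewrite -/(gamma_word mul m.+2 _ g) (gE (fun=> e)) => [|j jm]; last first.
    by rewrite x_e ?ltn_eqF // ltnW.
  by rewrite gamma_word_idem // eqxx ltn_eqF // xu xv eu.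
Qed.

(** For fixed [u], the Leibniz terms in which [d] misses the right factor are additive in that
    factor, so they cancel in the defect. *)
Lemma defect_mull u b x y : mul e c u = u ->
  D (mul u b x) (mul u b y) = mul u b (D x y).
Proof.
move=> eu; have [S [q [_ dE]]] := n_mult_derivation2.
apply: (defect_map (F := mul u b)
  (A := fun x => mul (mul S c u) b x + mul (q (d u)) b x)).
- by rewrite (gamma_mulDr hM).
- by rewrite !(gamma_mulDr hM) addrACA.
- by move=> v w; rewrite gamma_mulBr.
all: exact: dE.
Qed.

Lemma defect_mulr x y b v : mul e c x = x -> mul e c y = y ->
  D (mul x b v) (mul y b v) = mul (D x y) b v.
Proof.
move=> ex ey; have [S [q [qE dE]]] := n_mult_derivation2.
have exy : mul e c (x + y) = x + y by rewrite (gamma_mulDr hM) ex ey.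
have -> : mul (D x y) b v = mul (q (D x y)) b v.
  by case: qE => -> //; rewrite -defect_mull // ex ey.
apply: (defect_map (F := fun x => mul x b v)
  (A := fun x => mul (mul S c x) b v + mul x b (d v))
  (H := fun z => mul (q z) b v)) => [| | z w | | |].
- by rewrite (gamma_mulDl hM).
- by rewrite (gamma_mulDr hM) !(gamma_mulDl hM) addrACA.
- by case: qE => ->; rewrite ?gamma_mulBr // gamma_mulBl.
all: by rewrite dE // addrAC.
Qed.

End OneIdempotent.

(** * Peirce components of the defect for one idempotent *)

Section Peirce.

Variables (e : M) (c : G) (f : G -> M -> M) (f' : M -> G -> M).
Hypotheses (ece : mul e c e = e).
Hypotheses (f_c : forall a, f c a = a - mul e c a)
  (f'_c : forall a, f' a c = a - mul a c e)
  (ff'_assoc : forall a b be ga, mul (f' a be) ga b = mul a be (f ga b)).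
Hypothesis mul_eq0l : forall x, (forall b m, mul x b m = 0) -> x = 0.
Hypothesis mul_f'_eq0 : forall x,
  (forall m be ga, f' (mul (mul (mul e c x) c e) be m) ga = 0) ->
  mul (mul e c x) c e = 0.

(** [f] plays the role of 1 - e: associativity turns x c (f b m) into (x - x c e) b m. *)
Lemma mul_f_annih x b m : mul x c e = 0 -> mul x c (f b m) = mul x b m.
Proof. by move=> xe0; rewrite -ff'_assoc f'_c xe0 subr0. Qed.

Lemma mul_f_fix x b m : mul x c e = x -> mul x c (f b m) = 0.
Proof. by move=> xe; rewrite -ff'_assoc f'_c xe subrr gamma_mul0l. Qed.

Lemma mul_f'_idem x b : mul (f' x b) c e = 0.
Proof. by rewrite ff'_assoc f_c ece subrr gamma_mul0r. Qed.

(** By (ii) both sides may be compared after multiplication on the right, where [ff'_assoc] trades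
    [f'] for [f]. *)
Lemma f'_mul x b m g : f' (mul x b m) g = mul x b (f' m g).
Proof.
apply/eqP; rewrite -subr_eq0; apply/eqP/mul_eq0l => a z.
by rewrite gamma_mulBl // (gamma_mulA hM) !ff'_assoc (gamma_mulA hM) subrr.
Qed.

Let d0 := n_mult_derivation0.

Lemma defect11_12 x y : mul e c x = x -> mul x c e = x ->
  mul e c y = y -> mul y c e = 0 -> D x y = 0.
Proof.
move=> ex xe ey ye; apply: mul_eq0l => b m.
have De : mul (D x y) c e = 0.
  by rewrite -(defect_mulr ece) // ye defect0.
(* As [e] kills [D x y] on the right, [b m] may be replaced by [c (f b m)], which kills [x]. *)
rewrite -mul_f_annih // -(defect_mulr ece) // mul_f_fix //.
by rewrite defectC defect0.
Qed.

Lemma defect_mul12 x y b m : mul e c x = x ->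
  mul e c y = y -> mul y c e = 0 -> D x (mul y b m) = 0.
Proof.
move=> ex ey ye.
have efm : mul e c (f b m) = 0 by apply: mul_f_fix.
(* One right factor [x + f b m] serves both arguments: [e] turns it into [x] and [y] turns it into
   [y b m], so [D e y] = 0 applies. *)
have <- : mul e c (x + f b m) = x by rewrite (gamma_mulDr hM) ex efm addr0.
have <- : mul y c (x + f b m) = mul y b m.
  by rewrite (gamma_mulDr hM) mul_f_annih // -{1}ex -(gamma_mulA hM) ye
    gamma_mul0l // add0r.
by rewrite (defect_mulr ece) // (@defect11_12 e y) // gamma_mul0l.
Qed.

Lemma defect1_12 x y : mul e c x = x ->
  mul e c y = y -> mul y c e = 0 -> D x y = 0.
Proof.
move=> ex ey ye; apply: mul_eq0l => b m; rewrite -(defect_mulr ece) //.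
by apply: defect_mul12 => //; rewrite -(gamma_mulA hM) ex.
Qed.

Lemma defect11_11 x y : mul e c x = x -> mul x c e = x ->
  mul e c y = y -> mul y c e = y -> D x y = 0.
Proof.
move=> ex xe ey ye.
have DE : mul (mul e c (D x y)) c e = D x y.
  by rewrite -(defect_mull ece) // ex ey -(defect_mulr ece) // xe ye.
(* Right multiplication by [f' m ga] sends both arguments into M12, where the defect is known to
   vanish. *)
rewrite -DE; apply: mul_f'_eq0 => m be ga; rewrite DE f'_mul.
rewrite -(defect_mulr ece) //; apply: defect1_12.
- by rewrite -(gamma_mulA hM) ex.
- by rewrite -(gamma_mulA hM) ey.
- by rewrite (gamma_mulA hM) mul_f'_idem gamma_mul0r.
Qed.

Lemma defect1_1 x y : mul e c x = x -> mul e c y = y -> D x y = 0.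
Proof.
move=> ex ey; apply/defect_eq0.
have split1 z : mul e c z = z ->
    [/\ mul e c (mul z c e) = mul z c e,
        mul (mul z c e) c e = mul z c e,
        mul e c (z - mul z c e) = z - mul z c e &
        mul (z - mul z c e) c e = 0].
  move=> ez.
  by rewrite gamma_mulBr // gamma_mulBl // -!(gamma_mulA hM) ez
    [mul (mul z c e) c e](gamma_mulA hM) ece subrr.
have dD z w : mul e c z = z -> mul e c w = w -> mul w c e = 0 ->
    d (z + w) = d z + d w.
  by move=> ez ew we; apply/defect_eq0/defect1_12.
have [x1 x1e x2 x2e] := split1 x ex; have [y1 y1e y2 y2e] := split1 y ey.
set a := mul x c e in x1 x1e x2 x2e; set b := mul y c e in y1 y1e y2 y2e.
have dx : d x = d a + d (x - a) by rewrite -dD // [a + _]addrC subrK.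
have dy : d y = d b + d (y - b) by rewrite -dD // [b + _]addrC subrK.
(* Regroup by component: [defect1_12] splits off and separates the M12 terms, [defect11_11]
   separates [a] and [b]. *)
have -> : x + y = (a + b) + ((x - a) + (y - b)).
  by rewrite addrACA ![_ + (_ - _)]addrC !subrK.
rewrite dx dy dD.
- have /defect_eq0 -> := defect11_11 x1 x1e y1 y1e.
  by rewrite [d (_ + _)]dD // addrACA.
- by rewrite (gamma_mulDr hM) x1 y1.
- by rewrite (gamma_mulDr hM) x2 y2.
- by rewrite (gamma_mulDl hM) x2e y2e addr0.
Qed.

(** This is the premise of (iii), for arbitrary [x] and [y]: the left factor starts with [e], so
    moving it inside [D] puts both arguments in e c M. *)
Lemma mul_defect_eq0 x y b m g : mul (mul e b m) g (D x y) = 0.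
Proof.
have e1 a z : mul e c (mul e a z) = mul e a z by rewrite -(gamma_mulA hM) ece.
by rewrite -(defect_mull ece) // defect1_1 // !(gamma_mulA hM).
Qed.

End Peirce.
End Idempotent.

Theorem corollary4p4 (n : nat) (hn : (1 < n)%N)
  (M G : zmodType) (mul : M -> G -> M -> M) (hM : gamma_ring mul)
  (L : Type) (e : L -> M) (c : L -> G)
  (he : forall al, gamma_idempotent mul (c al) (e al))
  (f : L -> G -> M -> M) (f' : L -> M -> G -> M)
  (f_add : forall al, M_additive_l (f al))
  (f'_add : forall al, M_additive_r (f' al))
  (f_c : forall al a, f al (c al) a = a - mul (e al) (c al) a)
  (f'_c : forall al a, f' al a (c al) = a - mul a (c al) (e al))
  (ff'_assoc : forall al a b be ga,
     mul (f' al a be) ga b = mul a be (f al ga b))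
  (h_ii : forall x : M,
     setprod mul [set x] [set: G] [set: M] = [set 0] -> x = 0)
  (h_iii : forall x : M,
     (forall al,
        setprod mul (setprod mul [set e al] [set: G] [set: M])
                [set: G] [set x] = [set 0]) -> x = 0)
  (h_iv : forall al (x : M),
     (forall (m : M) (be ga : G),
        f' al (mul (mul (mul (e al) (c al) x) (c al) (e al)) be m) ga = 0) ->
     mul (mul (e al) (c al) x) (c al) (e al) = 0)
  (d : M -> M) (hd : n_mult_derivation mul n d) :
  forall x y : M, d (x + y) = d x + d y.
Proof.
have x_eq0l x : (forall b m, mul x b m = 0) -> x = 0.
  by move=> x0; apply/h_ii/setprod_eq0 => _ b m -> _ _.
move=> x y; apply/defect_eq0/h_iii => al; apply: setprod_eq0 => //.
move=> _ g _ [k [a [b [m [abP ->]]]]] _ ->.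
rewrite gamma_mul_suml //; apply: big1 => i _; have [-> _ _] := abP i.
exact: (mul_defect_eq0 hM hn hd (he al).2 (f_c al) (f'_c al) (ff'_assoc al)
  x_eq0l (h_iv al)).
Qed.
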